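(* Let $t\ge 2$, $n=4t^2$, and let $d>2$ be an integer. Consider the ensemble of order-$2$ FDPC codes of length $n$, with the permutation $\pi$ of $[n]$ chosen uniformly at random, and let $\mathcal{A}^{(2)}_w$ be the (random) number of codewords of weight $w$ in the resulting (unshortened) code. For $w=4,6,\dots,2(d-1)$ let $\alpha_w\ge\lfloor \mathbb{E}\{\mathcal{A}^{(2)}_w\}\rfloor$ be integers. Consider the ensemble of FDPC codes shortened by $\sum_{i=2}^{d-1}\alpha_{2i}$ bits, where, for each $i=2,\dots,d-1$, $\alpha_{2i}$ columns of $H$ are eliminated in order to reduce the number of weight-$2i$ codewords by $\alpha_{2i}$ (as specified in the context). Let $$\gamma=\sum_{i=2}^{d-1}\frac{\mathbb{E}\{\mathcal{A}^{(2)}_{2i}\}}{\alpha_{2i}+1}$$ and assume that $\gamma<1$. Then, for transmission over the binary erasure channel with erasure probability $\epsilon\in[0,1]$, the average error probability of the ML decoder over the ensemble of those shortened FDPC codes that have minimum distance $d_{\min}\ge 2d$ satisfies $$\mathbb{E}\{P_e^{(\mathrm{ML})}\}\le\frac{1}{1-\gamma}\sum_{w=2d}^{n}\mathbb{E}\{\mathcal{A}^{(2)}_w\}\,\epsilon^w .$$ Here the expectation on the left is over $\pi$ conditioned on the event that the shortened code has minimum distance at least $2d$, and the expectations on the right are over uniformly random $\pi$.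
   Context: Base matrix: for $t\ge 2$ and $n=4t^2$, $H_b$ is the binary $4t\times n$ matrix whose columns are all the binary column vectors of length $4t$ and Hamming weight two such that the indices of the two non-zero entries differ by an odd number (each such vector appearing exactly once, in some fixed order). Order-$2$ FDPC code: for a permutation $\pi$ of $[n]=\{1,\dots,n\}$, let $\pi(H_b)$ be the matrix obtained by permuting the columns of $H_b$ according to $\pi$. The order-$2$ FDPC code associated with $\pi$ is the binary linear code of length $n$ with parity-check matrix $H$ obtained by stacking $H_b$ on top of $\pi(H_b)$. Shortening: shortening a code at a coordinate means deleting the corresponding column from the parity-check matrix, i.e. keeping only the codewords that vanish at that coordinate and deleting that coordinate. For each code in the ensemble the shortening proceeds successively for $w=4,6,\dots,2(d-1)$: $\alpha_w$ columns are removed one at a time; each time, if the current code contains a codeword of weight $w$, the removed column is one whose index lies in the support of some such codeword, and otherwise an arbitrary column is removed. Thus, for each $w$, this either removes at least $\alpha_w$ codewords of weight $w$ or leaves no codeword of weight $w$. It is implicit that $\sum_i\alpha_{2i}<n$, so that the shortening is possible. A code with no non-zero codeword is regarded as having infinite minimum distance. ML decoding over the binary erasure channel BEC$(\epsilon)$: each transmitted bit is erased independently with probability $\epsilon$. $P_e^{(\mathrm{ML})}$ of a linear code is the probability that the ML decoder fails, where the decoder fails if and only if there is a non-zero codeword whose support is contained in the set of erased positions. *)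

(* Defs.v *)
From HB Require Import structures.
From mathcomp Require Import all_boot all_order all_algebra all_fingroup.
From mathcomp Require Import constructive_ereal reals.

Set Implicit Arguments.
Unset Strict Implicit.
Unset Printing Implicit Defensive.

Import Order.TTheory GRing.Theory Num.Theory.
Local Open Scope ring_scope.

Section Codes.
Context {r n : nat}.

Definition supp (c : 'rV['F_2]_n) : {set 'I_n} := [set i | c 0 i != 0].

Definition hamming_weight (c : 'rV['F_2]_n) : nat := #|supp c|.

Definition hamming_distance (c c' : 'rV['F_2]_n) : nat :=
  #|[set i | c 0 i != c' 0 i]|.

Definition code_of (H : 'M['F_2]_(r, n)) : {set 'rV['F_2]_n} :=
  [set c | H *m c^T == 0].

Definition weight_count (C : {set 'rV['F_2]_n}) (w : nat) : nat :=
  #|[set c in C | hamming_weight c == w]|.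

(* Equal to +oo when there are no two distinct codewords; for a linear code,
   when 0 is the only codeword. *)
Definition min_distance (C : {set 'rV['F_2]_n}) : \bar int :=
  \big[Order.min/+oo%E]_(p in setX C C | p.1 != p.2)
     ((hamming_distance p.1 p.2)%:Z)%:E.

Definition ml_failure (C : {set 'rV['F_2]_n}) (E : {set 'I_n}) : bool :=
  [exists c in C, (c != 0) && (supp c \subset E)].

End Codes.

(* E is the random set of erased positions. *)
Definition bec_prob (R : realType) (n : nat) (eps : R) (E : {set 'I_n}) : R :=
  \prod_(i < n) (if i \in E then eps else 1 - eps).

Definition ml_error_prob (R : realType) (n : nat) (eps : R)
    (C : {set 'rV['F_2]_n}) : R :=
  \sum_(E : {set 'I_n} | ml_failure C E) bec_prob eps E.

Definition base_column (m : nat) (v : 'cV['F_2]_m) : Prop :=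
  #|[set i | v i 0 != 0]| = 2%N /\
  forall i j : 'I_m, v i 0 != 0 -> v j 0 != 0 -> (i < j)%N -> odd (j - i).

(* The order of the columns is left open: every matrix that lists the admissible
   columns exactly once is a base matrix. *)
Definition base_matrix (m n : nat) (Hb : 'M['F_2]_(m, n)) : Prop :=
  (forall j, base_column (col j Hb)) /\
  (forall v, base_column v -> exists! j, col j Hb = v).

Definition fdpc_matrix (m n : nat) (Hb : 'M['F_2]_(m, n)) (pi : 'S_n) :
    'M['F_2]_(m + m, n) :=
  col_mx Hb (col_perm pi Hb).

Definition fdpc_weight_count (m n : nat) (Hb : 'M['F_2]_(m, n)) (w : nat)
    (pi : 'S_n) : nat :=
  weight_count (code_of (fdpc_matrix Hb pi)) w.

Definition removable (r n : nat) (w : nat) (H : 'M['F_2]_(r, n)) (j : 'I_n) :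
    Prop :=
  (exists2 c, c \in code_of H & hamming_weight c = w) ->
  exists c, [/\ c \in code_of H, hamming_weight c = w & j \in supp c].

(* [shortening ws H H']: H' arises from H by deleting one column for each entry
   w of ws, in order, the column being admissible for weight w in the current
   matrix. *)
Inductive shortening (r : nat) :
    seq nat -> forall n m : nat, 'M['F_2]_(r, n) -> 'M['F_2]_(r, m) -> Prop :=
| shortening_nil n (H : 'M['F_2]_(r, n)) : shortening [::] H H
| shortening_cons w ws n m (H : 'M['F_2]_(r, n.+1)) (j : 'I_n.+1)
    (H' : 'M['F_2]_(r, m)) :
    removable w H j -> shortening ws (col' j H) H' ->
    shortening (w :: ws) H H'.

(* alpha_4 times the weight 4, then alpha_6 times the weight 6, and so on up to
   alpha_(2(d-1)) times the weight 2(d-1). *)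
Definition shortening_schedule (d : nat) (alpha : nat -> nat) : seq nat :=
  flatten [seq nseq (alpha (2 * i)%N) (2 * i)%N | i <- index_iota 2 d].

Definition uniform_expectation (R : realType) (T : finType) (X : T -> R) : R :=
  (\sum_x X x) / #|T|%:R.

Definition uniform_cond_expectation (R : realType) (T : finType)
    (B : {set T}) (X : T -> R) : R :=
  uniform_expectation (fun x => X x * (x \in B)%:R) /
  uniform_expectation (fun x => (x \in B)%:R : R).

(* Main.v *)
(** Every nonzero codeword of the base code has even weight at least 4, and
    deleting a column of the parity-check matrix embeds the new code into the old
    one without changing weights. So if the shortened code has a nonzero codeword
    of weight below 2d, then for some 2 <= i < d the unshortened code had more
    than alpha_(2i) codewords of weight 2i; by Markov's inequality this happens
    with probability at most gamma. On the complementary event, the union bound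
    over codewords c, each covered by the erasures with probability
    eps^(weight of c), bounds the error probability by the weight enumerator of
    the unshortened code restricted to weights at least 2d. *)

Require Import Defs.
From HB Require Import structures.
From mathcomp Require Import all_boot all_order all_algebra all_fingroup.
From mathcomp Require Import constructive_ereal reals.

Set Implicit Arguments.
Unset Strict Implicit.
Unset Printing Implicit Defensive.

Import Order.TTheory GRing.Theory Num.Theory.
Local Open Scope ring_scope.

(** * Binary words, supports and weights *)

Lemma F2_neq0 (x : 'F_2) : (x != 0) = (x == 1).
Proof. by case: x => [[|[|m]] ?]. Qed.

Lemma F2_natr_eq0 k : (k%:R == 0 :> 'F_2) = ~~ odd k.
Proof. by rewrite -(dvdn_pcharf (pchar_Fp (isT : prime 2))) dvdn2. Qed.

Section Codewords.
Context {n : nat}.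
Implicit Types (c : 'rV['F_2]_n).

Lemma in_supp c i : (i \in supp c) = (c 0 i != 0).
Proof. by rewrite inE. Qed.

Lemma codeword_supp c i : c 0 i = (i \in supp c)%:R.
Proof.
rewrite in_supp; case: eqP => [-> //|/eqP].
by rewrite F2_neq0 => /eqP.
Qed.

Lemma supp_inj : injective (@supp n).
Proof. by move=> c c' e; apply/rowP => i; rewrite !codeword_supp e. Qed.

Lemma supp0 : supp (0 : 'rV['F_2]_n) = set0.
Proof. by apply/setP => i; rewrite in_supp mxE eqxx in_set0. Qed.

Lemma hamming_weight_eq0 c : (hamming_weight c == 0%N) = (c == 0).
Proof. by rewrite cards_eq0 -supp0 (inj_eq supp_inj). Qed.

Lemma hamming_weight_leq c : (hamming_weight c <= n)%N.
Proof. by rewrite -[leqRHS]card_ord max_card. Qed.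

Lemma hamming_distanceE c c' : hamming_distance c c' = hamming_weight (c - c').
Proof. by apply: eq_card => i; rewrite !inE !mxE subr_eq0. Qed.

(** Turns parity checks into statements about supports, for use with column deletion and words of
    weight two. *)
Lemma mulmx_codeword r (H : 'M['F_2]_(r, n)) c :
  H *m c^T = \sum_(j in supp c) col j H.
Proof.
apply/colP => i; rewrite mxE summxE [RHS]big_mkcond /=.
apply: eq_bigr => j _; rewrite !mxE codeword_supp.
by case: ifP => _; rewrite ?mulr1 ?mulr0.
Qed.

Lemma weight_count_gt0P (C : {set 'rV['F_2]_n}) w :
  reflect (exists2 c, c \in C & hamming_weight c = w) (0 < weight_count C w)%N.
Proof.
rewrite card_gt0; apply: (iffP (set0Pn _)) => -[c].
  by rewrite inE => /andP[cC /eqP wc]; exists c.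
by move=> cC wc; exists c; rewrite inE cC wc eqxx.
Qed.

(** By linearity, the distance of two codewords is the weight of their difference, and a weight is
    the distance to 0. The trivial code fits too, its minimum being [+oo]. *)
Lemma min_distance_geP r (H : 'M['F_2]_(r, n)) k :
  reflect (forall c, c \in code_of H -> c != 0 -> (k <= hamming_weight c)%N)
    ((k%:Z)%:E <= min_distance (code_of H))%E.
Proof.
apply: (iffP idP).
  move=> /bigmin_geP[_ le_k] c cC c0.
  have := le_k (c, 0); rewrite !inE /= => /(_ _).
  rewrite hamming_distanceE subr0 lee_fin lez_nat; apply.
  by rewrite trmx0 mulmx0 eqxx c0 !andbT; rewrite inE in cC.
move=> le_k; apply/bigmin_geP; split; first exact: leey.
move=> [c c']; rewrite !inE /= => /andP[/andP[/eqP cC /eqP c'C] cc'].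
rewrite hamming_distanceE lee_fin lez_nat le_k ?subr_eq0//.
by rewrite inE raddfB /= mulmxBr cC c'C subrr.
Qed.

End Codewords.

(** * Deleting columns of a parity-check matrix *)

Section Deletion.
Context {r n : nat}.
Implicit Types (H : 'M['F_2]_(r, n.+1)) (j : 'I_n.+1).

Definition insert_zero j (c : 'rV['F_2]_n) : 'rV['F_2]_n.+1 :=
  \row_k (if unlift j k is Some k' then c 0 k' else 0).

Lemma supp_insert_zero j c : supp (insert_zero j c) = lift j @: supp c.
Proof.
apply/setP => k; rewrite in_supp mxE; case: unliftP => [k' ->|->].
  by rewrite (mem_imset _ _ (@lift_inj _ j)) in_supp.
rewrite eqxx; apply/esym/negbTE/imsetP => -[k' _ /eqP].
by rewrite (negbTE (neq_lift _ _)).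
Qed.

Lemma insert_zero_inj j : injective (insert_zero j).
Proof.
move=> c c' /(congr1 (@supp _)); rewrite !supp_insert_zero.
by move=> /(imset_inj (@lift_inj _ j)) /supp_inj.
Qed.

Lemma hamming_weight_insert_zero j c :
  hamming_weight (insert_zero j c) = hamming_weight c.
Proof.
by rewrite /hamming_weight supp_insert_zero card_imset //; exact: lift_inj.
Qed.

Lemma insert_zero_code H j c :
  (insert_zero j c \in code_of H) = (c \in code_of (col' j H)).
Proof.
rewrite !inE !mulmx_codeword supp_insert_zero big_imset /=; last first.
  by move=> ? ? _ _; exact: lift_inj.
congr (_ == 0); apply: eq_bigr => k _.
by apply/colP => i; rewrite !mxE.
Qed.

Lemma weight_count_col' H j w :
  (weight_count (code_of (col' j H)) w <=
   #|[set c in code_of H | (hamming_weight c == w) && (j \notin supp c)]|)%N.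
Proof.
rewrite /weight_count -(card_imset _ (@insert_zero_inj j)); apply: subset_leq_card.
apply/subsetP => _ /imsetP[c + ->]; rewrite inE => /andP[cC wc].
rewrite inE insert_zero_code cC hamming_weight_insert_zero wc /=.
by rewrite in_supp mxE unlift_none eqxx.
Qed.

Lemma weight_count_col'_leq H j w :
  (weight_count (code_of (col' j H)) w <= weight_count (code_of H) w)%N.
Proof.
apply: leq_trans (weight_count_col' H j w) (subset_leq_card _).
by apply/subsetP => c; rewrite !inE => /and3P[-> ->].
Qed.

(** Words with [j] in their support do not survive, and [removable] supplies one of weight [w] if
    any exists. Otherwise the count is already 0, which the truncated [.-1] keeps at 0. *)
Lemma weight_count_removable H j w : removable w H j ->
  (weight_count (code_of (col' j H)) w <= (weight_count (code_of H) w).-1)%N.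
Proof.
move=> rem_j.
have [/weight_count_gt0P/rem_j[c [cC wc jc]]|] :=
  ltnP 0 (weight_count (code_of H) w).
  rewrite /weight_count (cardsD1 c) inE cC wc eqxx /=.
  apply: leq_trans (weight_count_col' H j w) (subset_leq_card _).
  apply/subsetP => c'; rewrite !inE => /and3P[-> -> jc']; rewrite !andbT.
  by apply: contraNneq jc' => ->; rewrite -in_supp.
by rewrite leqn0 => /eqP w0; have := weight_count_col'_leq H j w; rewrite w0.
Qed.

End Deletion.

Lemma weight_count_shortening r ws n m (H : 'M['F_2]_(r, n))
    (H' : 'M['F_2]_(r, m)) w : shortening ws H H' ->
  (weight_count (code_of H') w <= weight_count (code_of H) w - count_mem w ws)%N.
Proof.
elim=> {ws n m H H'} [n H|v ws n m H j H' rem_j _ IH]; first by rewrite subn0.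
apply: leq_trans IH _; rewrite /= subnDA leq_sub2r //.
have [ev|_] := eqVneq v w; last by rewrite subn0 weight_count_col'_leq.
by rewrite subn1 weight_count_removable // -ev.
Qed.

(** Distinct indices give distinct weights, so only the block of [i] contributes. *)
Lemma count_shortening_schedule d alpha i : (2 <= i < d)%N ->
  count_mem (2 * i)%N (shortening_schedule d alpha) = alpha (2 * i)%N.
Proof.
move=> i_d; rewrite count_flatten -map_comp.
rewrite sumnE big_map (bigD1_seq i) ?mem_index_iota ?iota_uniq //=.
rewrite count_nseq /= eqxx mul1n big1 ?addn0 // => k ki.
by rewrite count_nseq /= eqn_pmul2l // (negbTE ki).
Qed.

(** * Codeword weights in the base code *)

Section BaseCode.
Context {m n : nat} {Hb : 'M['F_2]_(m, n)} (hHb : base_matrix Hb).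

(** The two nonzero indices have opposite parity, so exactly one of them is even. *)
Lemma base_column_even_entries (v : 'cV['F_2]_m) : base_column v ->
  \sum_(i < m) (~~ odd i)%:R * v i 0 = 1.
Proof.
case=> /eqP/cards2P[a [b [ab sab]]] v_odd.
have sv i : (v i 0 != 0) = (i \in [set a; b]) by rewrite -sab inE.
have va : v a 0 != 0 by rewrite sv set21.
have vb : v b 0 != 0 by rewrite sv set22.
have odd_ab : odd a (+) odd b.
  have [lt_ab|lt_ba|/val_inj eab] := ltngtP a b.
  - by have := v_odd a b va vb lt_ab; rewrite oddB 1?ltnW // addbC.
  - by have := v_odd b a vb va lt_ba; rewrite oddB 1?ltnW.
  - by rewrite eab eqxx in ab.
rewrite (bigID [in [set a; b]]) /= [X in _ + X]big1 ?addr0; last first.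
  by move=> i; rewrite -sv negbK => /eqP ->; rewrite mulr0.
rewrite big_setU1 ?inE //= big_set1.
rewrite !F2_neq0 in va vb; rewrite (eqP va) (eqP vb) !mulr1.
by move: odd_ab; case: (odd a); case: (odd b); rewrite //= ?addr0 ?add0r.
Qed.

(* The columns are the edges of a bipartite graph between the even and the odd
   indices; summing the even rows gives the all-one parity check. *)
Lemma base_code_even c : c \in code_of Hb -> ~~ odd (hamming_weight c).
Proof.
rewrite inE => /eqP Hc; rewrite -F2_natr_eq0.
pose x : 'rV['F_2]_m := \row_i (~~ odd i)%:R.
have xH j : (x *m Hb) 0 j = 1.
  rewrite mxE -(base_column_even_entries (hHb.1 j)).
  by apply: eq_bigr => i _; rewrite !mxE.
have : (x *m (Hb *m c^T)) 0 0 == 0 by rewrite Hc mulmx0 mxE.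
rewrite mulmxA mulmx_codeword summxE.
under eq_bigr do rewrite mxE xH.
by rewrite sumr_const.
Qed.

(** A word of weight two would force two columns at different positions to be equal, but each
    admissible column is listed once. *)
Lemma base_code_weight_neq2 c : c \in code_of Hb -> hamming_weight c != 2%N.
Proof.
rewrite inE mulmx_codeword => Hc; apply/negP => /cards2P[a [b [ab sc]]].
move: Hc; rewrite sc big_setU1 ?inE //= big_set1 addr_eq0 => /eqP col_ab.
have oppb : - col b Hb = col b Hb.
  by apply/colP => i; rewrite !mxE oppr_pchar2 ?pchar_Fp.
have [k [_ uniq_k]] := hHb.2 _ (hHb.1 b).
by case/eqP: ab; rewrite -(uniq_k a) ?(uniq_k b) // col_ab oppb.
Qed.

Lemma base_code_weight c : c \in code_of Hb -> c != 0 ->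
  exists2 i, (2 <= i)%N & hamming_weight c = (2 * i)%N.
Proof.
move=> cC; have := base_code_even cC; have := base_code_weight_neq2 cC.
rewrite -hamming_weight_eq0 => w2 w_even w0.
have ew := even_halfK w_even.
exists (hamming_weight c)./2; last by rewrite mul2n ew.
by move: w2 w0; rewrite -ew; case: _./2 => [|[]].
Qed.

Lemma fdpc_code_sub pi : code_of (fdpc_matrix Hb pi) \subset code_of Hb.
Proof.
by apply/subsetP => c; rewrite !inE mul_col_mx col_mx_eq0 => /andP[].
Qed.

End BaseCode.

(** * Error probability on the erasure channel *)

Section Erasure.
Context {R : realType} {n : nat} (eps : R).

(** Expand a product of sums over subsets: position [i] contributes [eps] if erased and [G i] if
    not. As [G] vanishes on [A], only the sets containing [A] survive. *)
Lemma bec_prob_superset (A : {set 'I_n}) :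
  \sum_(E : {set 'I_n} | A \subset E) bec_prob eps E = eps ^+ #|A|.
Proof.
pose G i := if i \in A then 0 else 1 - eps.
transitivity (\prod_(i < n) (eps + G i)).
  rewrite bigA_distr [RHS](bigID (fun E : {set 'I_n} => A \subset E)) /=.
  rewrite [X in _ + X]big1 ?addr0; last first.
    move=> E /subsetPn[i iA iE].
    by rewrite (bigD1 i) //= (negbTE iE) /G iA mul0r.
  apply: eq_big => [E|E AE]; first by [].
  apply: eq_bigr => i _.
  case: ifPn => // iE; rewrite /G ifN //.
  by apply: contra iE; exact: (subsetP AE).
rewrite (bigID [in A]) /= [X in _ * X]big1 ?mulr1; last first.
  by move=> i iA; rewrite /G ifN // subrKC.
by rewrite (eq_bigr (fun=> eps)) ?prodr_const // => i iA; rewrite /G iA addr0.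
Qed.

Hypothesis eps01 : 0 <= eps <= 1.

Lemma bec_prob_ge0 (E : {set 'I_n}) : 0 <= bec_prob eps E.
Proof.
have [eps0 eps1] := andP eps01.
by apply: prodr_ge0 => i _; case: ifP; rewrite ?subr_ge0.
Qed.

Lemma ml_error_prob_ge0 (C : {set 'rV['F_2]_n}) : 0 <= ml_error_prob eps C.
Proof. by apply: sumr_ge0 => E _; exact: bec_prob_ge0. Qed.

Lemma ml_error_prob_union_bound (C : {set 'rV['F_2]_n}) :
  ml_error_prob eps C <= \sum_(c in C | c != 0) eps ^+ hamming_weight c.
Proof.
under [leRHS]eq_bigr do rewrite -bec_prob_superset big_mkcond.
rewrite exchange_big /= /ml_error_prob big_mkcond; apply: ler_sum => E _.
have term_ge0 c : 0 <= if supp c \subset E then bec_prob eps E else 0.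
  by case: ifP => _ //; exact: bec_prob_ge0.
case: ifPn => [/existsP[c /and3P[cC c0 cE]]|_]; last exact: sumr_ge0.
rewrite (bigD1 c) ?cC //= cE lerDl; exact: sumr_ge0.
Qed.

(** Groups the union bound by weight. The upper limit [N] is separate from [n] so that a shortened
    code can be summed up to the original length. *)
Lemma ml_error_prob_weight_bound (C : {set 'rV['F_2]_n}) k N :
  (n <= N)%N ->
  (forall c, c \in C -> c != 0 -> (k <= hamming_weight c)%N) ->
  ml_error_prob eps C <=
    \sum_(k <= w < N.+1) (weight_count C w)%:R * eps ^+ w.
Proof.
move=> nN le_k; apply: le_trans (ml_error_prob_union_bound C) _.
have [eps0 _] := andP eps01.
have countE w : (weight_count C w)%:R * eps ^+ w =
    \sum_(c in C) (if hamming_weight c == w then eps ^+ w else 0).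
  rewrite -big_mkcondr sumr_const /= mulr_natl.
  by congr (_ *+ _); apply: eq_card => c; rewrite inE.
under [leRHS]eq_bigr do rewrite countE.
rewrite exchange_big /= big_mkcondr /=; apply: ler_sum => c cC.
have inner_ge0 s (P : pred nat) : 0 <=
    \sum_(w <- s | P w) (if hamming_weight c == w then eps ^+ w else 0).
  by apply: sumr_ge0 => w _; case: ifP => _ //; exact: exprn_ge0.
(* The zero word is absent on the left and adds only nonnegative terms on the right; any other word
   is matched by the term at its own weight. *)
case: ifPn => c0; last exact: inner_ge0.
rewrite (bigD1_seq (hamming_weight c)) ?iota_uniq //=; last first.
  rewrite mem_index_iota le_k // ltnS.
  exact: leq_trans (hamming_weight_leq c) nN.
by rewrite eqxx lerDl.
Qed.

End Erasure.

(** * Averages over a finite type *)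

Section UniformExpectation.
Context {R : realType} {T : finType}.
Implicit Types X Y : T -> R.

Lemma uniform_expectation_le X Y : (forall x, X x <= Y x) ->
  uniform_expectation X <= uniform_expectation Y.
Proof. by move=> XY; rewrite ler_wpM2r ?invr_ge0 ?ler0n // ler_sum. Qed.

Lemma uniform_expectation_sum (r : seq nat) (X : nat -> T -> R) :
  uniform_expectation (fun x => \sum_(i <- r) X i x) =
  \sum_(i <- r) uniform_expectation (X i).
Proof. by rewrite /uniform_expectation exchange_big mulr_suml. Qed.

Lemma uniform_expectationMr X (a : R) :
  uniform_expectation (fun x => X x * a) = uniform_expectation X * a.
Proof. by rewrite /uniform_expectation -mulr_suml mulrAC. Qed.

Lemma uniform_expectation_ge0 X : (forall x, 0 <= X x) ->
  0 <= uniform_expectation X.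
Proof. by move=> X0; rewrite divr_ge0 ?sumr_ge0. Qed.

Lemma uniform_expectation1B X : (0 < #|T|)%N ->
  uniform_expectation (fun x => 1 - X x) = 1 - uniform_expectation X.
Proof.
move=> T0; rewrite /uniform_expectation sumrB sumr_const mulrBl divff //.
by rewrite pnatr_eq0 -lt0n.
Qed.

End UniformExpectation.

Theorem proposition5 (R : realType) (t n d : nat)
    (ht : (2 <= t)%N) (hn : n = (4 * t ^ 2)%N) (hd : (2 < d)%N)
    (Hb : 'M['F_2]_(4 * t, n)) (hHb : base_matrix Hb)
    (alpha : nat -> nat) :
  let EA (w : nat) : R :=
    uniform_expectation (fun pi : 'S_n => (fdpc_weight_count Hb w pi)%:R) in
  let gamma : R :=
    \sum_(2 <= i < d) EA (2 * i)%N / ((alpha (2 * i)%N)%:R + 1) in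
  forall (halpha : forall i : nat, (2 <= i < d)%N ->
            Num.floor (EA (2 * i)%N) <= (alpha (2 * i)%N)%:Z)
    (hsum : (\sum_(2 <= i < d) alpha (2 * i)%N < n)%N)
    (hgamma : gamma < 1)
    (Hs : 'S_n ->
       'M['F_2]_(4 * t + 4 * t, n - \sum_(2 <= i < d) alpha (2 * i)%N))
    (hHs : forall pi : 'S_n,
       shortening (shortening_schedule d alpha) (fdpc_matrix Hb pi) (Hs pi))
    (eps : R) (heps : 0 <= eps <= 1),
  uniform_cond_expectation
      [set pi : 'S_n |
         (((2 * d)%N%:Z)%:E <= min_distance (code_of (Hs pi)))%E]
      (fun pi => ml_error_prob eps (code_of (Hs pi)))
    <= (1 - gamma)^-1 * \sum_(2 * d <= w < n.+1) EA w * eps ^+ w.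
Proof.
move=> EA gamma _ _ hgamma Hs hHs eps heps.
set B := [set pi | _].
have inB pi : reflect
    (forall c, c \in code_of (Hs pi) -> c != 0 -> (2 * d <= hamming_weight c)%N)
    (pi \in B) by rewrite inE; exact: min_distance_geP.
have wc_le pi w : (weight_count (code_of (Hs pi)) w <=
    fdpc_weight_count Hb w pi - count_mem w (shortening_schedule d alpha))%N.
  exact: weight_count_shortening (hHs pi).
have [eps0 _] := andP heps.
have notB pi : pi \notin B -> exists2 i, (2 <= i < d)%N &
    (alpha (2 * i)%N < fdpc_weight_count Hb (2 * i)%N pi)%N.
  move=> /inB piB.
  have [c /and3P[cC c0 wc]|no_c] := pickP (fun c =>
      [&& c \in code_of (Hs pi), c != 0 & (hamming_weight c < 2 * d)%N]); last first.
    case: piB => c cC c0; rewrite leqNgt.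
    by have := no_c c; rewrite cC c0 /= => ->.
  have count_gt0 : (0 < weight_count (code_of (Hs pi)) (hamming_weight c))%N.
    by apply/weight_count_gt0P; exists c.
  have := leq_trans count_gt0 (wc_le pi _); rewrite subn_gt0.
  (* The unshortened code thus has a word [c'] of the same weight as [c]. Since [c'] lies in the
     base code, that weight is [2 * i] with [i] at least 2. *)
  move=> lt_count; have := leq_ltn_trans (leq0n _) lt_count.
  move=> /weight_count_gt0P[c' c'C wc'].
  have c'0 : c' != 0 by rewrite -hamming_weight_eq0 wc' hamming_weight_eq0.
  have [i i2 wi] := base_code_weight hHb (subsetP (fdpc_code_sub pi) _ c'C) c'0.
  rewrite wi in wc'; rewrite -wc' in wc lt_count.
  have i_d : (2 <= i < d)%N by rewrite i2; rewrite ltn_pmul2l in wc.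
  by exists i; rewrite // -(count_shortening_schedule alpha i_d).
have S_gt0 : (0 < #|{: 'S_n}|)%N by apply/card_gt0P; exists 1%g.
(* Markov and union bound at once: off B some summand of Y is at least 1, so
   1 - Y is pointwise at most the indicator of B. *)
have PB : 1 - gamma <= uniform_expectation (fun pi => (pi \in B)%:R : R).
  pose Y pi : R := \sum_(2 <= i < d)
    (fdpc_weight_count Hb (2 * i)%N pi)%:R / ((alpha (2 * i)%N)%:R + 1).
  have Y0 i pi : 0 <=
      (fdpc_weight_count Hb (2 * i)%N pi)%:R / ((alpha (2 * i)%N)%:R + 1) :> R.
    by rewrite divr_ge0 ?addr_ge0.
  have -> : gamma = uniform_expectation Y.
    rewrite uniform_expectation_sum; apply: eq_bigr => i _.
    by rewrite uniform_expectationMr.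
  rewrite -uniform_expectation1B //; apply: uniform_expectation_le => pi.
  have [_|/notB[i i_d lt_alpha]] := boolP (pi \in B).
    by rewrite gerBl sumr_ge0.
  (* A natural number exceeding [alpha (2 * i)] is at least [alpha (2 * i) + 1], the denominator of
     the summand at [i]. *)
  rewrite subr_le0 /Y (bigD1_seq i) ?iota_uniq ?mem_index_iota //=.
  rewrite ler_wpDr ?sumr_ge0 // ler_pdivlMr ?mul1r ?ltr_wpDl //.
  by rewrite natr1 ler_nat.
have EX : uniform_expectation
      (fun pi => ml_error_prob eps (code_of (Hs pi)) * (pi \in B)%:R) <=
    \sum_(2 * d <= w < n.+1) EA w * eps ^+ w.
  under [leRHS]eq_bigr do rewrite -uniform_expectationMr.
  rewrite -uniform_expectation_sum; apply: uniform_expectation_le => pi.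
  (* Off [B] the indicator kills the left side; on [B] the minimum distance lets the weight sum
     start at [2 * d]. *)
  have [/inB piB|_] := boolP (pi \in B); last first.
    by rewrite mulr0 sumr_ge0 // => w _; rewrite mulr_ge0 ?exprn_ge0.
  rewrite mulr1.
  apply: le_trans (ml_error_prob_weight_bound heps (leq_subr _ n) piB) _.
  apply: ler_sum => w _; rewrite ler_wpM2r ?exprn_ge0 // ler_nat.
  exact: leq_trans (wc_le pi w) (leq_subr _ _).
have gamma_lt : 0 < 1 - gamma by rewrite subr_gt0.
(* The conditioning event has positive probability, so the division is genuine and inversion
   reverses the bound [PB]. *)
have PB_gt0 := lt_le_trans gamma_lt PB.
rewrite /uniform_cond_expectation mulrC.
apply: ler_pM => //.
- by rewrite invr_ge0 ltW.
- by apply: uniform_expectation_ge0 => pi; rewrite mulr_ge0 ?ml_error_prob_ge0.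
- by rewrite lef_pV2.
Qed.
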